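(* For any $a\in H$ and $\tau\in\mathfrak{r}_-^{\times}$, one has $$a\cdot O_\tau=O_{a\cdot\tau}.$$
   Context: Let $\mathfrak{g}$ be a complex semisimple Lie algebra with triangular decomposition $\mathfrak{g}=\mathfrak{n}_-+\mathfrak{h}+\mathfrak{n}$, where $\mathfrak{h}$ is a Cartan subalgebra and $\mathfrak{b}=\mathfrak{h}+\mathfrak{n}$ is a Borel subalgebra. $\Delta\subset\mathfrak{h}^*$ is the set of roots, $\Delta_+$ the set of roots of $\mathfrak{n}$, and $\Pi\subset\Delta_+$ the simple roots. For each root $\varphi$ let $e_\varphi$ be a root vector, chosen so that $(e_\varphi,e_{-\varphi})=1$ for the Killing form $(\cdot,\cdot)$; the same notation is used for the induced form on $\mathfrak{h}^*$. $G$ is a complex simply connected semisimple Lie group with Lie algebra $\mathfrak{g}$, and $H,N,B$ are the (connected) Lie subgroups corresponding to $\mathfrak{h},\mathfrak{n},\mathfrak{b}$. Action. Let $P:\mathfrak{g}\to\mathfrak{n}_-$ be the projection along $\mathfrak{b}$ in $\mathfrak{g}=\mathfrak{n}_-\oplus\mathfrak{b}$. Using the Killing form, $\mathfrak{n}_-$ is identified with $\mathfrak{n}^*$; the coadjoint action of $N$ on $\mathfrak{n}_-$ is $u\cdot v=P\,\mathrm{Ad}\,u(v)$, and it extends to an action of $B$ on $\mathfrak{n}_-$ by $b\cdot v=P\,\mathrm{Ad}\,b(v)$. For $z\in\mathfrak{n}_-$, $O_z$ is the $N$-coadjoint orbit of $z$. Cascade. For $\varphi\in\Delta_+$ write $\varphi=\sum_{\alpha\in\Pi}n_\alpha(\varphi)\alpha$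 and put $\Pi(\varphi)=\{\alpha\in\Pi\mid n_\alpha(\varphi)>0\}$, a connected set defining a simple Lie subalgebra $\mathfrak{g}(\varphi)$ with simple roots $\Pi(\varphi)$. $\varphi$ is locally high if it is the highest root of $\mathfrak{g}(\varphi)$. If so, put $\Pi(\varphi)^o=\{\alpha\in\Pi(\varphi)\mid(\alpha,\varphi)=0\}$, let $\mathfrak{g}(\varphi)^o$ be the semisimple Lie algebra with simple roots $\Pi(\varphi)^o$, and call $\varphi'$ an offspring of $\varphi$ if $\varphi'$ is the highest root of a simple component of $\mathfrak{g}(\varphi)^o$ (it is again locally high). A cascade chain is a sequence $\beta_1',\ldots,\beta_k'$ in which $\beta_1'$ is the highest root of a simple component of $\mathfrak{g}$ and each $\beta_j'$, $j>1$, is an offspring of $\beta_{j-1}'$. The cascade $\mathcal{B}$ is the set of all members of cascade chains. $\mathfrak{r}_-^{\times}=\{\sum_{\beta\in\mathcal{B}}a_\beta e_{-\beta}\mid a_\beta\in\mathbb{C},\ a_\beta\ne0\ \text{for all }\beta\in\mathcal{B}\}\subset\mathfrak{n}_-$; it is stable under $H$. *)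

(* Defs.v *)
(* Complex numbers are [R[i]] with [R : realType];
   holomorphy is complex Frechet differentiability ([differentiable] over the
   field [R[i]]) at every point of an open set. *)
From HB Require Import structures.
From mathcomp Require Import all_boot all_order all_algebra.
From mathcomp Require Import all_classical all_reals all_analysis.
From mathcomp Require Import complex.

Set Implicit Arguments.
Unset Strict Implicit.
Unset Printing Implicit Defensive.

Import Order.TTheory GRing.Theory Num.Theory.
Import numFieldNormedType.Exports.
Local Open Scope classical_set_scope.
Local Open Scope ring_scope.
Local Open Scope complex_scope.

HB.instance Definition _ (R : realType) :=
  NormedModule.copy R[i] (R[i] : numFieldType)^o.

(** * Finite-dimensional Lie algebras *)

HB.mixin Record isLieAlgebra (K : fieldType) g of Vector K g := {
  bracket : g -> g -> g ;
  bracket_linearl : forall y, linear (bracket^~ y) ;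
  bracket_linearr : forall x, linear (bracket x) ;
  bracketxx : forall x, bracket x x = 0 ;
  bracket_jacobi : forall x y z,
    bracket x (bracket y z) + bracket y (bracket z x) + bracket z (bracket x y)
      = 0
}.

#[short(type="lieAlgType")]
HB.structure Definition LieAlgebra (K : fieldType) :=
  {g of isLieAlgebra K g & Vector K g}.

Section LieAlgebraTheory.
Variables (K : fieldType) (g : lieAlgType K).
Implicit Types U V I J m h b : {vspace g}.

Definition ad (x : g) : 'End(g) := linfun (bracket x).

(* the trace of ad x o ad y, computed in a basis of g *)
Definition killing (x y : g) : K :=
  \sum_(i < \dim {:g})
     coord (vbasis {:g}) i (bracket x (bracket y (vbasis {:g})`_i)).

(* [U, V]: the span of all brackets *)
Definition lie_prod U V : {vspace g} :=
  <<[seq bracket x y | x <- vbasis U, y <- vbasis V]>>%VS.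

Definition subalgebra U := (lie_prod U U <= U)%VS.
Definition ideal_of I m := (I <= m)%VS && (lie_prod m I <= I)%VS.

Definition solvable_alg U :=
  exists k, iter k (fun V => lie_prod V V) U = 0%VS.
Definition nilpotent_alg U := exists k, iter k (lie_prod U) U = 0%VS.

Definition semisimple_alg := forall I,
  ideal_of I fullv -> solvable_alg I -> I = 0%VS.

Definition simple_alg m :=
  [/\ subalgebra m, lie_prod m m != 0%VS &
      forall J, ideal_of J m -> J = 0%VS \/ J = m].

Definition simple_component m I := ideal_of I m /\ simple_alg I.

Definition cartan_subalgebra h :=
  [/\ subalgebra h, nilpotent_alg h &
      forall x, (forall y, y \in h -> bracket x y \in h) -> x \in h].

Definition borel_subalgebra b :=
  [/\ subalgebra b, solvable_alg b &
      forall b', subalgebra b' -> solvable_alg b' -> (b <= b')%VS -> b' = b].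

(* The subalgebra generated by [U]; the increasing sequence of subspaces is
   stationary after at most [\dim g] steps. *)
Definition lie_gen U : {vspace g} :=
  iter (\dim {:g}) (fun V => (V + lie_prod V V)%VS) U.

End LieAlgebraTheory.

(* The dual space h^* *)
Notation dualsp h := 'Hom(subvs_of h, GRing.regular _).

Section Roots.
Variables (K : fieldType) (g : lieAlgType K) (h : {vspace g}).

Definition root_space (phi : dualsp h) : {vspace g} :=
  (\bigcap_(b <- vbasis {:subvs_of h})
     lker (ad (vsval b) - (phi b : K) *: \1%VF))%VS.

Definition is_root (phi : dualsp h) :=
  (phi != 0) && (root_space phi != 0%VS).

(* The element of h representing [phi] under the Killing form, and the form
   induced on h^* *)
Definition killing_dual (phi : dualsp h) : subvs_of h :=
  xget 0 [set t | forall x, killing (vsval t) (vsval x) = phi x].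

Definition dual_form (phi psi : dualsp h) : K :=
  killing (vsval (killing_dual phi)) (vsval (killing_dual psi)).

End Roots.

(* g = n_- + h + n, with h Cartan, b = h + n Borel, n the sum of the root spaces
   it contains and n_- the sum of the opposite ones.  [tri_roots] enumerates the
   (finitely many) roots. *)
Record triangular (K : fieldType) (g : lieAlgType K) := Triangular {
  tri_nm : {vspace g} ;
  tri_h : {vspace g} ;
  tri_n : {vspace g} ;
  tri_roots : seq (dualsp tri_h) ;
  tri_roots_uniq : uniq tri_roots ;
  tri_rootsP : forall phi, (phi \in tri_roots) = is_root phi ;
  tri_cartan : cartan_subalgebra tri_h ;
  tri_borel : borel_subalgebra (tri_h + tri_n)%VS ;
  tri_n_subalg : subalgebra tri_n ;
  tri_nm_subalg : subalgebra tri_nm ;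
  tri_nE : tri_n =
    (\sum_(phi <- tri_roots | (root_space phi <= tri_n)%VS) root_space phi)%VS ;
  tri_nmE : tri_nm =
    (\sum_(phi <- tri_roots | (root_space phi <= tri_n)%VS)
        root_space (- phi))%VS ;
  tri_direct : directv (tri_nm + tri_h + tri_n)%VS ;
  tri_full : (tri_nm + tri_h + tri_n = fullv)%VS
}.

(** * Locally high roots and the cascade *)

Section Cascade.
Variables (K : numFieldType) (g : lieAlgType K) (D : triangular g).
Local Notation h := (tri_h D).
Local Notation Delta := (tri_roots D).
Local Notation hdual := (dualsp h).

Definition tri_b : {vspace g} := (h + tri_n D)%VS.

(* The projection g -> n_- along b *)
Definition proj_nm : 'End(g) := daddv_pi (tri_nm D) tri_b.

Definition pos_roots : seq hdual :=
  [seq phi <- Delta | (root_space phi <= tri_n D)%VS].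

Definition simple_roots : seq hdual :=
  [seq phi <- pos_roots | ~~ has (fun psi => phi - psi \in pos_roots) pos_roots].

(* n_alpha(phi), for alpha the [i]-th simple root *)
Definition root_coef (phi : hdual) (i : 'I_(size simple_roots)) : K :=
  coord (in_tuple simple_roots) i phi.

(* Pi(phi) *)
Definition root_supp (phi : hdual) : seq hdual :=
  [seq simple_roots`_(val i) |
     i <- enum 'I_(size simple_roots) & 0 < root_coef phi i].

(* The semisimple subalgebra with set of simple roots [S] *)
Definition sub_of_roots (S : seq hdual) : {vspace g} :=
  lie_gen (\sum_(alpha <- S) (root_space alpha + root_space (- alpha)))%VS.

(* [psi] is the highest root of the subalgebra [m], whose roots are the roots of
   g with root space inside [m] *)
Definition highest_root (m : {vspace g}) (psi : hdual) :=
  [/\ psi \in Delta, (root_space psi <= m)%VS &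
      forall phi, phi \in Delta -> (root_space phi <= m)%VS ->
        exists c : 'I_(size simple_roots) -> nat,
          psi - phi = \sum_(i < size simple_roots) simple_roots`_i *+ c i].

Definition locally_high (phi : hdual) :=
  phi \in pos_roots /\ highest_root (sub_of_roots (root_supp phi)) phi.

(* Pi(phi)^o *)
Definition root_supp_orth (phi : hdual) : seq hdual :=
  [seq alpha <- root_supp phi | dual_form alpha phi == 0].

Definition offspring (phi phi' : hdual) :=
  locally_high phi /\
  exists I, simple_component (sub_of_roots (root_supp_orth phi)) I /\
            highest_root I phi'.

Inductive cascade_chain : seq hdual -> Prop :=
| CascadeTop I beta :
    simple_component fullv I -> highest_root I beta -> cascade_chain [:: beta]
| CascadeNext s beta beta' :
    cascade_chain (rcons s beta) -> offspring beta beta' ->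
    cascade_chain (rcons (rcons s beta) beta').

Definition cascade (beta : hdual) :=
  exists2 s, cascade_chain s & beta \in s.

Definition root_vectors (e : hdual -> g) := forall phi, phi \in Delta ->
  e phi \in root_space phi /\ killing (e phi) (e (- phi)) = 1.

(* r_-^x *)
Definition rm_cross (e : hdual -> g) : set g :=
  [set tau | exists2 a : hdual -> K,
     (forall beta, cascade beta -> a beta != 0) &
     tau = \sum_(beta <- Delta | `[< cascade beta >]) a beta *: e (- beta)].

End Cascade.

(** * Complex Lie groups *)

(* [cinv] is the inverse of [cmap : cdom -> cmap @` cdom]; the values of [cmap]
   off [cdom] and of [cinv] off [cmap @` cdom] are irrelevant. *)
Record chart (R : realType) (n : nat) (G : topologicalType) := Chart {
  cdom : set G ;
  cmap : G -> 'rV[R[i]]_n ;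
  cinv : 'rV[R[i]]_n -> G ;
  cdom_open : open cdom ;
  cimg_open : open (cmap @` cdom) ;
  cmapK : forall x, cdom x -> cinv (cmap x) = x ;
  cmap_continuous : forall x, cdom x -> {for x, continuous cmap} ;
  cinv_continuous : forall p, (cmap @` cdom) p -> {for p, continuous cinv}
}.

HB.mixin Record isComplexLieGroup (R : realType) (n : nat) G
    of Group G & Topological G := {
  atlas : set (chart R n G) ;
  lie_hausdorff : hausdorff_space G ;
  lie_second_countable : @second_countable G ;
  atlas_cover : forall x : G, exists2 c, atlas c & cdom c x ;
  atlas_holomorphic : forall c1 c2, atlas c1 -> atlas c2 ->
    forall x, cdom c1 x -> cdom c2 x ->
      differentiable (cmap c2 \o cinv c1) (cmap c1 x) ;
  lie_mul_continuous : continuous (fun p : G * G => (p.1 * p.2)%g) ;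
  lie_inv_continuous : continuous (fun x : G => (x^-1)%g) ;
  lie_mul_holomorphic : forall c1 c2 c3, atlas c1 -> atlas c2 -> atlas c3 ->
    forall x y, cdom c1 x -> cdom c2 y -> cdom c3 (x * y)%g ->
      differentiable
        (fun p : 'rV[R[i]]_n * 'rV[R[i]]_n =>
           cmap c3 (cinv c1 p.1 * cinv c2 p.2)%g)
        (cmap c1 x, cmap c2 y) ;
  lie_inv_holomorphic : forall c1 c2, atlas c1 -> atlas c2 ->
    forall x, cdom c1 x -> cdom c2 (x^-1)%g ->
      differentiable (fun p => cmap c2 (cinv c1 p)^-1%g) (cmap c1 x)
}.

#[short(type="complexLieGroupType")]
HB.structure Definition ComplexLieGroup (R : realType) (n : nat) :=
  {G of isComplexLieGroup R n G & Group G & Topological G}.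

Definition simply_connected (R : realType) (T : topologicalType) :=
  (forall x y : T, exists f : R -> T,
     [/\ {within `[0, 1], continuous f}, f 0 = x & f 1 = y]) /\
  (forall f : R -> T, {within `[0, 1], continuous f} -> f 0 = f 1 ->
     exists F : R * R -> T,
       [/\ {within `[0, 1] `*` `[0, 1], continuous F},
           forall t, 0 <= t <= 1 -> F (0, t) = f t /\ F (1, t) = f 0 &
           forall s, 0 <= s <= 1 -> F (s, 0) = f 0 /\ F (s, 1) = f 0]).

(* Conjugation by [a] differentiated at the identity, in the coordinates of a
   chart [c] around the identity *)
Definition Ad_chart (R : realType) (n : nat) (G : complexLieGroupType R n)
    (c : chart R n G) (a : G) : 'rV[R[i]]_n -> 'rV[R[i]]_n :=
  'd (fun p => cmap c (a * cinv c p * a^-1)%g) (cmap c 1%g).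

(* An identification of the tangent space at the identity, read in the chart
   [id_chart], with [g].  The Lie bracket of the tangent space is the
   differential of Ad at the identity: d(Ad)_1(u)(v) = [u, v]. *)
Record lie_algebra_of (R : realType) (n : nat) (G : complexLieGroupType R n)
    (g : lieAlgType R[i]) := LieAlgebraOf {
  id_chart : chart R n G ;
  id_chart_atlas : atlas id_chart ;
  id_chart1 : cdom id_chart 1%g ;
  from_tangent : {linear 'rV[R[i]]_n -> g} ;
  to_tangent : g -> 'rV[R[i]]_n ;
  from_tangentK : cancel from_tangent to_tangent ;
  to_tangentK : cancel to_tangent from_tangent ;
  dAdE : forall v, is_diff (cmap id_chart 1%g)
    (fun p => Ad_chart id_chart (cinv id_chart p) v)
    (fun u => to_tangent (bracket (from_tangent u) (from_tangent v)))
}.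

Section Adjoint.
Variables (R : realType) (n : nat) (G : complexLieGroupType R n).
Variables (g : lieAlgType R[i]) (L : lie_algebra_of G g).

Definition Ad (a : G) (x : g) : g :=
  from_tangent L (Ad_chart (id_chart L) a (to_tangent L x)).

Definition one_parameter (gamma : R[i] -> G) :=
  [/\ forall s t, gamma (s + t) = (gamma s * gamma t)%g,
      continuous gamma &
      forall (c : chart R n G) t, atlas c -> cdom c (gamma t) ->
        differentiable (cmap c \o gamma) t].

(* [y = exp x]: exp x is the time-one value of the one-parameter subgroup with
   velocity [x] at 0. *)
Definition is_exp (x : g) (y : G) := exists gamma : R[i] -> G,
  [/\ one_parameter gamma,
      'D_1 (cmap (id_chart L) \o gamma) 0 = to_tangent L x &
      gamma 1 = y].

Definition is_subgroup (S : set G) :=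
  [/\ S 1%g, forall x y, S x -> S y -> S (x * y)%g &
      forall x, S x -> S (x^-1)%g].

(* The connected Lie subgroup corresponding to a Lie subalgebra [u], as the
   subgroup generated by exp(u) *)
Definition lie_subgroup (u : {vspace g}) : set G :=
  [set y | forall S, is_subgroup S ->
     (forall x z, x \in u -> is_exp x z -> S z) -> S y].

Variable D : triangular g.

(* [b . v = P Ad b (v)]; an action on n_- when [b] ranges over the subgroup
   corresponding to [tri_b D] *)
Definition coad (b : G) (v : g) : g := proj_nm D (Ad b v).

Definition coad_orbit (z : g) : set g :=
  [set coad u z | u in lie_subgroup (tri_n D)].

End Adjoint.

(* Main.v *)
(* For [b] in [B], [Ad b] preserves the Lie algebra of [B], which is the kernel
   of [P]; hence [P Ad b P = P Ad b].  As [Ad] is multiplicative,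
     a . (u . tau) = P Ad(a u) tau = (a u a^-1) . (a . tau),
   and [a] normalizes [N], because [a exp(x) a^-1 = exp(Ad a x)] and [Ad a]
   preserves [n].
   A subspace [W] with [[x, W] <= W] is preserved by [Ad (exp x)]: if [q] is a
   projection with kernel [W] and [gamma] the one-parameter subgroup of [x],
   then [z t = q (Ad (gamma t) w)] solves a linear differential equation with
   [z 0 = 0], so that [z = 0]. *)
Require Import Defs.
From HB Require Import structures.
From mathcomp Require Import all_boot all_order all_algebra.
From mathcomp Require Import all_classical all_reals all_analysis.
From mathcomp Require Import complex ring lra.
Set Implicit Arguments.
Unset Strict Implicit.
Unset Printing Implicit Defensive.

Import Order.TTheory GRing.Theory Num.Theory.
Import numFieldNormedType.Exports.
Local Open Scope classical_set_scope.
Local Open Scope ring_scope.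
Local Open Scope complex_scope.

(** * Differentials of germs and derivatives of finite sums *)

Lemma near_eq_is_diff (K : numFieldType) (V W : normedModType K)
    (f g df : V -> W) (x : V) :
  (\near x, f x = g x) -> is_diff x f df -> is_diff x g df.
Proof.
move=> fg [/diff_locallyP[dfc fE] dfE].
(* The first-order expansion at [x] depends only on the germ there, so the expansion of [f] is also
   one of [g]; [diff_unique] then identifies the differentials. *)
have gE : g \o shift x = cst (g x) + 'd f x +o_ 0 id.
  apply/eqaddoP => eps eps0.
  move/eqaddoP : fE => /(_ eps eps0).
  have fg0 : \forall y \near 0, f (y + x) = g (y + x).
    by move: fg; rewrite (near_shift 0) subr0.
  apply: filterS2 fg0 => y /= fgy.
  rewrite !fctE /= fgy.
  by rewrite (nbhs_singleton fg).
have dgE := diff_unique dfc gE.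
apply: DiffDef; last by rewrite dgE.
by apply/diff_locallyP; rewrite dgE.
Qed.

Lemma is_derive_fsum (K : numFieldType) (V W : normedModType K) (I : finType)
    (h : I -> V -> W) (x v : V) (dh : I -> W) :
  (forall i, is_derive x v (h i) (dh i)) ->
  is_derive x v (fun y => \sum_i h i y) (\sum_i dh i).
Proof.
move=> hP; rewrite (_ : (fun y => _) = \sum_i h i); last first.
  by apply/funext => y; rewrite fct_sumE.
by elim/big_rec2: _ => [|i f df _ fP]; [exact: is_derive_cst|exact: is_deriveD].
Qed.

(** * Uniqueness for linear systems of differential equations *)

Lemma linear_ode_eq0 (R : realType) (I : finType) (B : I -> I -> R)
    (u : I -> R -> R) :
  (forall i (t : R), is_derive t 1 (u i) (\sum_j B i j * u j t)) ->
  (forall i, u i 0 = 0) -> forall i t, 0 <= t -> u i t = 0.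
Proof.
move=> du u0 i t t0.
(* Gronwall: [exp(- k t) E t] is nonincreasing, nonnegative and zero at 0. *)
pose E s := \sum_i u i s ^+ 2.
pose dE s := \sum_i 2 * (u i s * \sum_j B i j * u j s).
(* Each of the terms [2 * u j * B j l * u l] of [dE] is at most [|B j l| * 2 * E], because
   [|u j * u l| <= E]; [k] collects these constants. *)
pose k := \sum_i \sum_j `|B i j| * 2.
have E_ge0 s : 0 <= E s by apply: sumr_ge0 => j _; exact: sqr_ge0.
have le_E j s : u j s ^+ 2 <= E s.
  by rewrite /E (bigD1 j) //= lerDl sumr_ge0 // => l _; exact: sqr_ge0.
have EP (s : R) : is_derive s 1 E (dE s).
  apply: is_derive_fsum => j.
  rewrite (_ : (fun _ => _) = u j * u j); last first.
    by apply/funext => r; rewrite expr2.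
  apply: (is_derive_eq (is_deriveM (du j s) (du j s))).
  by rewrite /GRing.scale /=; ring.
have dE_le (s : R) : dE s <= k * E s.
  rewrite /dE /k mulr_suml; apply: ler_sum => j _.
  rewrite mulr_suml !mulr_sumr; apply: ler_sum => l _.
  have -> : 2 * (u j s * (B j l * u l s)) = B j l * (2 * (u j s * u l s)).
    by ring.
  have uu_le : `|u j s * u l s| <= E s.
    have := le_E j s; have := le_E l s.
    have : 0 <= (`|u j s| - `|u l s|) ^+ 2 by exact: sqr_ge0.
    rewrite -(real_normK (num_real (u j s))) -(real_normK (num_real (u l s))).
    rewrite normrM; nra.
  apply: le_trans (ler_norm _) _; rewrite normrM -mulrA ler_wpM2l //.
  by rewrite normrM ger0_norm // ler_wpM2l.
pose F s := expR (- k * s) * E s.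
have FP (s : R) : is_derive s 1 F (expR (- k * s) * (dE s - k * E s)).
  have h1 : is_derive s 1 (fun s : R => expR (- k * s)) (expR (- k * s) * - k).
    have := is_derive1_comp (is_derive_expR (- k * s))
      (is_deriveZ (- k) (is_derive_id s 1)).
    by rewrite scaler1.
  apply: (is_derive_eq (is_deriveM h1 (EP s))).
  rewrite /GRing.scale /=; ring.
have : F t <= F 0.
  apply: (@ler0_derive1_le_cc _ F 0 t) => //; rewrite ?in_itv /= ?lexx ?t0 //.
  - by move=> s _; rewrite derive1E derive_val mulr_ge0_le0 ?expR_ge0 //
      subr_le0.
  - apply: continuous_subspaceT => s.
    exact/differentiable_continuous/derivable1_diffP/ex_derive.
have -> : F 0 = 0.
  by rewrite /F /E big1 ?mulr0 // => j _; rewrite u0 expr0n.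
rewrite pmulr_rle0 ?expR_gt0 // => E_le0.
by apply/eqP; rewrite -sqrf_eq0 eq_le sqr_ge0 andbT (le_trans (le_E i t)).
Qed.

(** Meant for [rho] the real or imaginary part: as [rho] commutes with real scalars, the real
    difference quotient is the image under [rho] of the complex one, and [rho] is continuous because
    it does not increase the norm. *)
Lemma is_derive_real_linear (R : realType) (rho : R[i] -> R) (f : R[i] -> R[i])
    (t : R) (l : R[i]) :
  {morph rho : x y / x - y} -> (forall (r : R) z, rho (r%:C * z) = r * rho z) ->
  (forall z, `|rho z|%:C <= `|z|) ->
  is_derive (t%:C : R[i]) (1 : R[i]) f l ->
  is_derive t (1 : R) (fun s => rho (f s%:C)) (rho l).
Proof.
move=> rhoB rhoZ rho_le [fd fl].
have rho_cont : continuous rho.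
  move=> z A /nbhs_ballP[/= eps eps0 epsA].
  apply/nbhs_ballP; exists eps%:C => /=; first by rewrite ltcR.
  move=> y; rewrite /ball /= => y_lt; apply: epsA; rewrite /ball /=.
  rewrite -rhoB -ltcR; apply: le_lt_trans (rho_le _) _.
  exact: y_lt.
have C_cont : (fun r : R => r%:C) @ 0^' --> (0 : R[i])^'.
  move=> A /nbhs_ballP[/= eps eps0 epsA].
  (* In the partial order of [R[i]], a positive [eps] is necessarily real. *)
  have Eeps : (complex.Re eps)%:C = eps by rewrite RRe_real // gtr0_real.
  apply/nbhs_ballP; exists (complex.Re eps) => /=; first by rewrite -ltcR Eeps.
  move=> r /=; rewrite /ball /= => r_lt r0; apply: epsA; last first.
    by apply: contra_neq r0 => /complexI.
  rewrite /ball /= sub0r normrN -Eeps.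
  have -> : `|r%:C| = `|r|%:C.
    by rewrite normc_def /= expr0n addr0 sqrtr_sqr.
  by rewrite ltcR -normrN -[- r]sub0r.
have fC : (fun h : R[i] =>
    h^-1 *: ((f \o shift t%:C) (h *: (1 : R[i])) - f t%:C))
    @ (0 : R[i])^' --> l.
  rewrite -fl; exact: fd.
have cv : (fun h : R => h^-1 *: (((fun s => rho (f s%:C)) \o shift t) (h *: 1)
    - rho (f t%:C))) @ 0^' --> rho l.
  rewrite (_ : (fun h : R => _) = (fun r : R =>
      rho (r%:C^-1 *: ((f \o shift t%:C) (r%:C *: (1 : R[i])) - f t%:C)))).
    exact: (cvg_comp _ _ (cvg_comp _ _ C_cont fC) (rho_cont l)).
  apply/funext => r /=.
  rewrite /GRing.scale /= !mulr1 -rhoB -rmorphD -rhoZ.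
  by rewrite fmorphV.
apply: DeriveDef; first exact: (cvgP _ cv).
exact: (cvg_lim _ cv).
Qed.

(** Along the real axis, the real and imaginary parts of [z] solve a real linear system of twice the
    size, indexed by [bool * I]. *)
Lemma complex_linear_ode_eq0 (R : realType) (I : finType) (M : I -> I -> R[i])
    (z : I -> R[i] -> R[i]) :
  (forall i (t : R[i]), is_derive t (1 : R[i]) (z i) (\sum_j M i j * z j t)) ->
  (forall i, z i 0 = 0) -> forall i, z i 1 = 0.
Proof.
move=> dz z0 i.
pose part (b : bool) (w : R[i]) := if b then complex.Re w else complex.Im w.
have partB b : {morph part b : x y / x - y} by case: b; case=> ? ? [].
have partD b : {morph part b : x y / x + y} by case: b; case=> ? ? [].
have part0 b : part b 0 = 0 by case: b.
have partZ b (r : R) w : part b (r%:C * w) = r * part b w.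
  by case: b; case: w => ? ?; rewrite /= mul0r ?subr0 ?addr0.
have part_le b w : `|part b w|%:C <= `|w|.
  case: b; first exact: normc_ge_Re.
  have -> : part false w = - complex.Re (w * 'i%C) by rewrite ReiNIm opprK.
  rewrite normrN; apply: le_trans (normc_ge_Re _) _; rewrite normrM.
  by rewrite [`|'i%C|]normc_def /= expr0n expr1n add0r sqrtr1 mulr1.
pose u (k : bool * I) (s : R) := part k.1 (z k.2 s%:C).
(* The real block matrix of multiplication by [M], with rows [(Re M, - Im M)] and [(Im M, Re M)];
   [true] marks real parts. *)
pose B (k l : bool * I) : R := if k.1 == l.1 then complex.Re (M k.2 l.2)
  else if l.1 then complex.Im (M k.2 l.2) else - complex.Im (M k.2 l.2).
have u_eq0 k : u k 1 = 0.
  apply: (@linear_ode_eq0 R _ B) => // {}k; last by rewrite /u z0 part0.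
  move=> t.
  have := is_derive_real_linear (partB k.1) (partZ k.1) (part_le k.1)
    (dz k.2 t%:C).
  move=> h; apply: (is_derive_eq h).
  rewrite (big_morph _ (partD _) (part0 _)).
  rewrite -(pair_bigA _ (fun b j => B k (b, j) * u (b, j) t)) /=.
  rewrite exchange_big /=.
  apply: eq_bigr => j _; rewrite big_bool /B /u /=.
  by case: k.1; case: (M _ _) => ? ?; case: (z _ _) => ? ? /=; ring.
have := u_eq0 (true, i); have := u_eq0 (false, i); rewrite /u rmorph1 /=.
by case: (z i 1) => ? ? /= -> ->.
Qed.

(** * Conjugation in charts and multiplicativity of [Ad_chart] *)

Section LieGroup.
Context {R : realType} {n : nat} {G : complexLieGroupType R n}.
Implicit Types (a b x : G) (c : chart R n G).

(** Chart domains are open, so passing through a chart and back does not change the germ of a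
    continuous map. With [near_eq_is_diff], this allows charts to be inserted in the middle of a
    composition. *)
Lemma cmapK_near (T : topologicalType) (f : T -> G) (t : T) c :
  {for t, continuous f} -> cdom c (f t) ->
  \near t, cinv c (cmap c (f t)) = f t.
Proof.
move=> fc cft.
have : \near t, cdom c (f t).
  by apply: fc; apply: open_nbhs_nbhs; split=> //; exact: cdom_open.
by apply: filterS => s /cmapK.
Qed.

Lemma mulg_continuous_at (T : topologicalType) (f h : T -> G) (t : T) :
  {for t, continuous f} -> {for t, continuous h} ->
  {for t, continuous (fun s => f s * h s)%g}.
Proof.
move=> fc hc.
apply: (@continuous2_cvg T G G G (nbhs t) _ f h
  (fun y z => (y * z)%g) (f t) (h t)) => //.
exact: (@lie_mul_continuous R n G (f t, h t)).
Qed.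

Lemma cinv_continuous_at c x : cdom c x -> {for cmap c x, continuous (cinv c)}.
Proof. by move=> cx; apply: cinv_continuous; exists x. Qed.

(** Restrict the jointly holomorphic product to the slice where the first factor is [a], read in a
    chart around [a]. *)
Lemma mulgl_differentiable c1 c2 a x : atlas c1 -> atlas c2 ->
  cdom c1 x -> cdom c2 (a * x)%g ->
  differentiable (fun p => cmap c2 (a * cinv c1 p)%g) (cmap c1 x).
Proof.
move=> A1 A2 c1x c2ax; have [c A ca] := atlas_cover a.
have := @lie_mul_holomorphic R n G _ _ _ A A1 A2 _ _ ca c1x c2ax => hd.
rewrite (_ : (fun p => _) = (fun p : 'rV[R[i]]_n * 'rV[R[i]]_n =>
  cmap c2 (cinv c p.1 * cinv c1 p.2)%g) \o (fun p => (cmap c a, p)));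
  last first.
  by apply/funext => p /=; rewrite cmapK.
exact: differentiable_comp.
Qed.

Lemma mulgr_differentiable c1 c2 b x : atlas c1 -> atlas c2 ->
  cdom c1 x -> cdom c2 (x * b)%g ->
  differentiable (fun p => cmap c2 (cinv c1 p * b)%g) (cmap c1 x).
Proof.
move=> A1 A2 c1x c2xb; have [c A cb] := atlas_cover b.
have := @lie_mul_holomorphic R n G _ _ _ A1 A A2 _ _ c1x cb c2xb => hd.
rewrite (_ : (fun p => _) = (fun p : 'rV[R[i]]_n * 'rV[R[i]]_n =>
  cmap c2 (cinv c1 p.1 * cinv c p.2)%g) \o (fun p => (p, cmap c b)));
  last first.
  by apply/funext => p /=; rewrite cmapK.
exact: differentiable_comp.
Qed.

(** Conjugation is a left translation followed by a right one, joined through a chart [c] around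
    [a * x]; the composite agrees with conjugation only near [cmap c1 x]. *)
Lemma conjg_differentiable c1 c2 a x : atlas c1 -> atlas c2 ->
  cdom c1 x -> cdom c2 (a * x * a^-1)%g ->
  differentiable (fun p => cmap c2 (a * cinv c1 p * a^-1)%g) (cmap c1 x).
Proof.
move=> A1 A2 c1x c2x; have [c A cax] := atlas_cover (a * x)%g.
have d1 := mulgl_differentiable A1 A c1x cax.
have d2 := mulgr_differentiable A A2 cax c2x.
have e : cmap c (a * x)%g = (fun p => cmap c (a * cinv c1 p)%g) (cmap c1 x).
  by rewrite cmapK.
rewrite e in d2.
have /differentiableP d := differentiable_comp d1 d2.
have eqn : \forall p \near cmap c1 x,
    ((fun q => cmap c2 (cinv c q * a^-1)%g) \o
     (fun p => cmap c (a * cinv c1 p)%g)) p = cmap c2 (a * cinv c1 p * a^-1)%g.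
  have cont : {for cmap c1 x, continuous (fun p => a * cinv c1 p)%g}.
    apply: mulg_continuous_at; first exact: cst_continuous.
    exact: cinv_continuous_at.
  have := cmapK_near cont.
  rewrite (cmapK c1x) => /(_ c cax).
  by apply: filterS => p /= ->.
exact: (@ex_diff _ _ _ _ _ _ _ (near_eq_is_diff eqn d)).
Qed.

Lemma is_diff_conjg (U : normedModType R[i]) (f : U -> G) (t : U) c1 c2 a
    (df : U -> 'rV[R[i]]_n) :
  atlas c1 -> atlas c2 -> {for t, continuous f} ->
  cdom c1 (f t) -> cdom c2 (a * f t * a^-1)%g -> is_diff t (cmap c1 \o f) df ->
  is_diff t (fun s => cmap c2 (a * f s * a^-1)%g)
    ('d (fun p => cmap c2 (a * cinv c1 p * a^-1)%g) (cmap c1 (f t)) \o df).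
Proof.
move=> A1 A2 fc c1f c2f fP.
have /differentiableP cP := conjg_differentiable A1 A2 c1f c2f.
apply: near_eq_is_diff (is_diff_comp fP cP).
have := cmapK_near fc c1f.
by apply: filterS => s /= ->.
Qed.

Lemma Ad_chart1 c v : cdom c 1%g -> Ad_chart c 1%g v = v.
Proof.
move=> c1; have c1P : open_nbhs (cmap c 1%g) (cmap c @` cdom c).
  by split; [exact: cimg_open|exists 1%g].
have : is_diff (cmap c 1%g) (fun p => cmap c (1 * cinv c p * 1^-1)%g) id.
  apply: near_eq_is_diff (is_diff_id _).
  apply: filterS (open_nbhs_nbhs c1P) => _ [y cy <-].
  by rewrite cmapK // mul1g invg1 mulg1.
by move=> [_ dE]; rewrite /Ad_chart dE.
Qed.

(** Chain rule for conjugation by [b] followed by conjugation by [a]; both fix the identity, so the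
    one chart [c] serves throughout. *)
Lemma Ad_chartM c a b v : atlas c -> cdom c 1%g ->
  Ad_chart c (a * b)%g v = Ad_chart c a (Ad_chart c b v).
Proof.
move=> A c1.
have cinv1 : cinv c (cmap c 1%g) = 1%g by rewrite cmapK.
have conj1 y : (y * 1 * y^-1 = 1 :> G)%g by rewrite mulg1 mulgV.
have db : differentiable (fun p => cmap c (b * cinv c p * b^-1)%g) (cmap c 1%g).
  by apply: conjg_differentiable => //; rewrite conj1.
have := @is_diff_conjg _ (fun p => b * cinv c p * b^-1)%g (cmap c 1%g) c c a
  ('d (fun p => cmap c (b * cinv c p * b^-1)%g) (cmap c 1%g)).
rewrite cinv1 !conj1 => /(_ A A).
case=> //.
- apply: mulg_continuous_at; last exact: cst_continuous.
  apply: mulg_continuous_at; first exact: cst_continuous.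
  exact: cinv_continuous_at.
- move=> _ /(congr1 (fun h => h v)) dE; rewrite /Ad_chart.
  have -> : (fun p => cmap c (a * b * cinv c p * (a * b)^-1)%g) =
      (fun p => cmap c (a * (b * cinv c p * b^-1) * a^-1)%g).
    by apply/funext => p; rewrite invgM !mulgA.
  exact: dE.
Qed.

End LieGroup.

(** * Derivatives of translated curves and of linear forms along curves *)

Lemma is_derive_translate (K : numFieldType) (V : normedModType K) (f : K -> V)
    (t : K) (l : V) :
  is_derive (0 : K) (1 : K) f l -> is_derive t (1 : K) (fun s => f (s - t)) l.
Proof.
have eqf : (fun h : K => h^-1 *: (((fun s => f (s - t)) \o shift t) (h *: 1)
    - f (t - t))) = (fun h : K => h^-1 *: ((f \o shift 0) (h *: 1) - f 0)).
  by apply/funext => h; rewrite /= addrK addr0 subrr.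
by move=> [fd fl]; apply: DeriveDef;
  [rewrite /derivable eqf|rewrite -fl /derive eqf].
Qed.

Lemma is_derive_row_form (K : numFieldType) (n : nat) (f : K -> 'rV[K]_n)
    (t : K) (df : 'rV[K]_n) (w : 'I_n -> K) :
  is_derive t (1 : K) f df ->
  is_derive t (1 : K) (fun s => \sum_j f s 0 j * w j) (\sum_j df 0 j * w j).
Proof.
move=> [fd <-]; apply: is_derive_fsum => j.
have coord_lin : linear (fun N : 'rV[K]_n => N 0 j : K).
  by move=> k M N; rewrite !mxE.
(* The coordinate is packed as a linear map so that [diff_lin] gives its differential. *)
have [coord_j coord_jE] : exists l : {linear 'rV[K]_n -> K},
    l = (fun N : 'rV[K]_n => N 0 j) :> (_ -> _).
  pose l : {linear 'rV[K]_n -> K} := HB.pack (fun N : 'rV[K]_n => N 0 j : K)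
    (GRing.isLinear.Build K 'rV[K]_n K *:%R _ coord_lin).
  by exists l.
have coord_cont : continuous coord_j.
  by rewrite coord_jE; exact: coord_continuous.
have /derivable1_diffP fdiff := fd.
have cd := linear_differentiable (f t) coord_cont.
have gd := differentiable_comp fdiff cd.
have gP : is_derive t (1 : K) (coord_j \o f) (coord_j ('D_1 f t)).
  apply: DeriveDef; first exact: diff_derivable.
  by rewrite deriveE // diff_comp //= diff_lin // deriveE.
rewrite (_ : (fun s => _) = w j *: (coord_j \o f)); last first.
  by apply/funext => s; rewrite coord_jE mulrC.
by apply: (is_derive_eq (is_deriveZ (w j) gP)); rewrite coord_jE mulrC.
Qed.

(** * Subspaces stable under the bracket *)

HB.instance Definition _ (K : fieldType) (g : lieAlgType K) (x : g) :=
  GRing.isLinear.Build K g g *:%R (bracket x) (bracket_linearr x).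

Section LieAlgebra.
Context {K : fieldType} {g : lieAlgType K}.
Implicit Types (U V W : {vspace g}) (x y : g).

Definition bracket_stable U W :=
  forall x w, x \in U -> w \in W -> bracket x w \in W.

Lemma bracket_suml (I : Type) (r : seq I) (P : pred I) (F : I -> g) y :
  bracket (\sum_(i <- r | P i) F i) y = \sum_(i <- r | P i) bracket (F i) y.
Proof.
pose f : {linear g -> g} := HB.pack (bracket^~ y)
  (GRing.isLinear.Build K g g *:%R (bracket^~ y) (bracket_linearl y)).
exact: (linear_sum f).
Qed.

Lemma bracketZl k x y : bracket (k *: x) y = k *: bracket x y.
Proof.
pose f : {linear g -> g} := HB.pack (bracket^~ y)
  (GRing.isLinear.Build K g g *:%R (bracket^~ y) (bracket_linearl y)).
exact: (linearZ_LR f).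
Qed.

Lemma mem_lie_prod U V x y : x \in U -> y \in V -> bracket x y \in lie_prod U V.
Proof.
move=> /coord_vbasis -> /coord_vbasis ->.
rewrite bracket_suml; apply: memv_suml => i _; rewrite bracketZl linear_sum.
apply: memvZ; apply: memv_suml => j _; rewrite linearZ; apply: memvZ.
by apply: memv_span; apply: allpairs_f; apply: mem_nth; rewrite size_tuple.
Qed.

Lemma subalgebra_bracket_stable U V :
  subalgebra V -> (U <= V)%VS -> bracket_stable U V.
Proof.
move=> sV UV x w /(subvP UV) xV wV.
by apply: (subvP sV); exact: mem_lie_prod.
Qed.

(** By definition the basis vectors of [h] act on [root_space phi] by scalars; linearity extends
    stability to all of [h]. *)
Lemma root_space_stable (h : {vspace g}) (phi : dualsp h) :
  bracket_stable h (root_space phi).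
Proof.
move=> x w xh wphi.
have xE : x = vsval (Subvs xh) by [].
rewrite xE (coord_vbasis (memvf (Subvs xh))) linear_sum bracket_suml.
apply: memv_suml => i _; rewrite linearZ bracketZl; apply: memvZ.
set b := (_`_i); have bB : b \in (vbasis {:subvs_of h} : seq _).
  by apply: mem_nth; rewrite size_tuple.
have : w \in lker (ad (vsval b) - (phi b : K) *: \1%VF).
  apply: subvP wphi; rewrite /root_space.
  by rewrite (big_rem b bB) /= capvSl.
rewrite memv_ker !lfunE /= !lfunE /= subr_eq0 => /eqP.
by rewrite /ad lfunE /= lfunE /= => ->; exact: memvZ.
Qed.

Lemma tri_h_n_stable (D : triangular g) : bracket_stable (tri_h D) (tri_n D).
Proof.
move=> x w xh; rewrite tri_nE.
move: w; elim/big_rec: _ => [w|phi V _ IH w].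
  by rewrite memv0 => /eqP ->; rewrite linear0 mem0v.
case/memv_addP => u uphi [v vV ->]; rewrite linearD.
by apply: memv_add; [exact: root_space_stable|exact: IH].
Qed.

End LieAlgebra.

(** * The projection onto [tri_nm D] along [tri_b D] *)

Section TriangularProj.
Context {K : numFieldType} {g : lieAlgType K} (D : triangular g).

Lemma tri_b_stable U : (U <= tri_b D)%VS -> bracket_stable U (tri_b D).
Proof. by apply: subalgebra_bracket_stable; have [] := tri_borel D. Qed.

(** A dimension count: the triple sum is direct and [tri_b D] has dimension at most that of
    [tri_h D] plus that of [tri_n D], which leaves no room for an intersection. *)
Lemma tri_nm_b_eq0 : (tri_nm D :&: tri_b D = 0)%VS.
Proof.
apply/eqP; rewrite -dimv_eq0 -leqn0.
have := dimv_sum_cap (tri_nm D) (tri_b D).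
have := tri_direct D; rewrite directvE /= -addvA => /eqP ->.
have [le_dim _] := dimv_add_leqif (tri_h D) (tri_n D).
move=> /eqP; rewrite -addnA -addnA eqn_add2l addnA => /eqP dimE.
by rewrite -(leq_add2l (\dim (tri_h D) + \dim (tri_n D))) dimE addn0.
Qed.

Lemma proj_nm_add v : proj_nm D v + daddv_pi (tri_b D) (tri_nm D) v = v.
Proof.
apply: daddv_pi_add; first exact: tri_nm_b_eq0.
by rewrite addvA tri_full memvf.
Qed.

Lemma proj_nm_eq0 w : w \in tri_b D -> proj_nm D w = 0.
Proof.
move=> wb; apply: (addIr w); rewrite add0r -[RHS]proj_nm_add; congr (_ + _).
by rewrite daddv_pi_id // capvC tri_nm_b_eq0.
Qed.

Lemma sub_proj_nm v : v - proj_nm D v \in tri_b D.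
Proof. by rewrite -{1}[v]proj_nm_add addrC addKr memv_pi. Qed.

End TriangularProj.

(** * The adjoint action on exponentials and on the subgroups they generate *)

Section Adjoint.
Context {R : realType} {n : nat} {G : complexLieGroupType R n}.
Context {g : lieAlgType R[i]} {L : lie_algebra_of G g}.
Local Notation c := (id_chart L).
Implicit Types (a b y : G) (x w : g) (U W : {vspace g}).

Lemma to_tangent_linear : linear (to_tangent L).
Proof.
move=> k u v; apply: (can_inj (from_tangentK L)).
by rewrite linearP !to_tangentK.
Qed.

Lemma Ad_linear a : linear (Ad L a).
Proof. by move=> k u v; rewrite /Ad /Ad_chart to_tangent_linear !linearP. Qed.

HB.instance Definition _ a :=
  GRing.isLinear.Build R[i] g g *:%R (Ad L a) (Ad_linear a).

Lemma Ad1 w : Ad L 1%g w = w.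
Proof. by rewrite /Ad Ad_chart1 ?to_tangentK //; exact: id_chart1. Qed.

Lemma AdM a b w : Ad L (a * b)%g w = Ad L a (Ad L b w).
Proof.
rewrite /Ad Ad_chartM ?from_tangentK //.
  exact: id_chart_atlas.
exact: id_chart1.
Qed.

Lemma one_parameter0 (gam : R[i] -> G) : one_parameter gam -> gam 0 = 1%g.
Proof.
by case=> gamD _ _; apply: (mulgI (gam 0)); rewrite -gamD addr0 mulg1.
Qed.

(** At 0 this is the chain rule with [dAdE]. Time [t] reduces to time 0 by writing
    [gam s = gam (s - t) * gam t] and using multiplicativity. *)
Lemma is_derive_Ad_chart (gam : R[i] -> G) x (t : R[i]) (v : 'rV[R[i]]_n) :
  one_parameter gam -> 'D_1 (cmap c \o gam) 0 = to_tangent L x ->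
  is_derive t (1 : R[i]) (fun s => Ad_chart c (gam s) v)
    (to_tangent L (bracket x (from_tangent L (Ad_chart c (gam t) v)))).
Proof.
move=> gamP dgam; have gam0 := one_parameter0 gamP.
have [gamD gamc gamd] := gamP.
have c1 := id_chart1 L; have A := id_chart_atlas L.
have at0 u : is_derive (0 : R[i]) (1 : R[i]) (fun s => Ad_chart c (gam s) u)
    (to_tangent L (bracket x (from_tangent L u))).
  have cg0 : cdom c (gam 0) by rewrite gam0.
  have dg0 := gamd c 0 A cg0.
  have d0 := dAdE L u.
  rewrite -gam0 in d0.
  have := is_diff_comp (differentiableP dg0) d0.
  have near_c : \forall s \near (0 : R[i]),
     ((fun p => Ad_chart c (cinv c p) u) \o (cmap c \o gam)) s
     = Ad_chart c (gam s) u.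
    have := cmapK_near (gamc 0) cg0.
    by apply: filterS => s /= ->.
  move=> /(near_eq_is_diff near_c) [hd hE].
  apply: DeriveDef; first exact: diff_derivable.
  rewrite deriveE // hE /= -deriveE // dgam.
  by rewrite to_tangentK.
rewrite (_ : (fun s => _) = (fun s =>
  Ad_chart c (gam (s - t)) (Ad_chart c (gam t) v))).
  exact: (is_derive_translate _ (at0 _)).
apply/funext => s.
by rewrite -(Ad_chartM (gam (s - t)) (gam t) v A c1) -gamD subrK.
Qed.

Lemma is_exp_stable x y W : is_exp L x y ->
  (forall w, w \in W -> bracket x w \in W) ->
  forall w, w \in W -> Ad L y w \in W.
Proof.
case=> gam [gamP dgam <-] xW w wW.
pose Y s := Ad L (gam s) w.
pose q : 'End(g) := daddv_pi (W^C)%VS W.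
have capW : (W^C :&: W = 0)%VS by rewrite capvC capv_compl.
have qK v : v - q v \in W.
  have vE : q v + daddv_pi W (W^C)%VS v = v.
    by apply: daddv_pi_add => //; rewrite addvC addv_complf memvf.
  by rewrite -{1}vE addrC addKr memv_pi.
have qW v : v \in W -> q v = 0.
  move=> vW; have : q v \in (W^C :&: W)%VS.
    by rewrite memv_cap memv_pi /= -(subKr v (q v)) rpredB.
  by rewrite capW memv0 => /eqP.
(* Since [bracket x] preserves [W], the kernel of [q], it descends to the quotient by [W]. Hence the
   equation for [q (Y s)] involves only [q (Y s)], and its coordinates [z] form a closed linear
   system. *)
have q_bracket v : q (bracket x v) = q (bracket x (q v)).
  apply/eqP; rewrite -subr_eq0 -linearB -linearB; apply/eqP.
  by apply: qW; apply: xW; exact: qK.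
pose z (i : 'I_(\dim {:g})) (s : R[i]) := coord (vbasis {:g}) i (q (Y s)).
pose M (i j : 'I_(\dim {:g})) :=
  coord (vbasis {:g}) i (q (bracket x (vbasis {:g})`_j)).
have zM i s :
    coord (vbasis {:g}) i (q (bracket x (Y s))) = \sum_j M i j * z j s.
  rewrite q_bracket {1}(coord_vbasis (memvf (q (Y s)))) !linear_sum /=.
  by apply: eq_bigr => j _; rewrite !linearZ /= mulrC.
(* The derivative of [Ad_chart] is known in tangent coordinates, so the functional is rewritten as a
   form in those. *)
have formE i (v : 'rV[R[i]]_n) : coord (vbasis {:g}) i (q (from_tangent L v)) =
    \sum_j v 0 j * coord (vbasis {:g}) i (q (from_tangent L (delta_mx 0 j))).
  rewrite {1}(row_sum_delta v) !linear_sum /=.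
  by apply: eq_bigr => j _; rewrite !linearZ.
have z_eq0 i : z i 1 = 0.
  apply: (complex_linear_ode_eq0 (M := M)) => {}i.
    move=> t; rewrite -zM.
    have := is_derive_Ad_chart t (to_tangent L w) gamP dgam.
    move=> /(is_derive_row_form (fun j =>
      coord (vbasis {:g}) i (q (from_tangent L (delta_mx 0 j))))).
    rewrite -formE to_tangentK.
    rewrite (_ : (fun s => _) = z i) //.
    by apply/funext => s; rewrite -formE.
  by rewrite /z /Y (one_parameter0 gamP) Ad1 qW // linear0.
have qY : q (Y 1) = 0.
  rewrite (coord_vbasis (memvf (q (Y 1)))) big1 // => i _.
  by rewrite [coord _ _ _](z_eq0 i) scale0r.
by rewrite -[Ad L _ _]subr0 -qY; exact: qK.
Qed.

(** The conjugate of the one-parameter subgroup of [x] is again one, and the chain rule gives it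
    velocity [Ad L a x] at 0. *)
Lemma is_exp_conjg a x y : is_exp L x y -> is_exp L (Ad L a x) (a * y * a^-1)%g.
Proof.
case=> gam [gamP dgam <-]; have gam0 := one_parameter0 gamP.
have [gamD gamc gamd] := gamP.
have c1 := id_chart1 L; have A := id_chart_atlas L.
(* Arbitrary charts are needed for holomorphy at every time; the velocity uses [c] on both sides. *)
have conjP c1' c2' t : atlas c1' -> atlas c2' -> cdom c1' (gam t) ->
    cdom c2' (a * gam t * a^-1)%g ->
    is_diff t (fun s => cmap c2' (a * gam s * a^-1)%g)
    ('d (fun p => cmap c2' (a * cinv c1' p * a^-1)%g) (cmap c1' (gam t)) \o
      'd (cmap c1' \o gam) t).
  move=> A1 A2 d1 d2; apply: is_diff_conjg => //; first exact: gamc.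
  exact: differentiableP (gamd _ _ _ _).
exists (fun s => a * gam s * a^-1)%g; split => //.
- split.
  + by move=> s t; rewrite gamD -[(a * gam t * _)%g]mulgA divgKA !mulgA.
  + move=> t.
    have cl : {for t, continuous (fun s => a * gam s)%g}.
      by apply: mulg_continuous_at; [exact: cst_continuous|exact: gamc].
    have := mulg_continuous_at cl (@cst_continuous _ _ (a^-1)%g t).
    exact.
  + move=> c' t A' ct; have [c0 A0 d0] := atlas_cover (gam t).
    by have [] := conjP c0 c' t A0 A' d0 ct.
- have g0c : cdom c (gam 0) by rewrite gam0.
  have := conjP c c 0 A A g0c; rewrite gam0 mulg1 mulgV => /(_ c1) [hd hE].
  have dg0 := gamd c 0 A g0c.
  rewrite deriveE // hE /= -(deriveE _ dg0) dgam.
  by rewrite /Ad from_tangentK.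
Qed.

(** [Ad L a] is injective and [W] is finite-dimensional, so it maps [W] onto [W]. This gives closure
    under inverses for the stabilizer of [W]. *)
Lemma Ad_stableV a W : (forall w, w \in W -> Ad L a w \in W) ->
  forall w, w \in W -> Ad L a^-1%g w \in W.
Proof.
move=> aW w wW; pose f : 'End(g) := linfun (Ad L a).
have fE v : f v = Ad L a v by rewrite lfunE.
have f_ker : lker f = 0%VS.
  apply/eqP/lker0P => u v; rewrite !fE => uv.
  by rewrite -[u]Ad1 -[v]Ad1 -[1%g](mulVg a) !AdM uv.
have f_img : (f @: W = W)%VS.
  apply/eqP; rewrite eqEdim limg_dim_eq ?leqnn ?andbT;
    last by rewrite f_ker capv0.
  by apply/subvP => _ /memv_imgP[v vW ->]; rewrite fE; exact: aW.
move: wW; rewrite -{1}f_img => /memv_imgP[v vW ->].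
by rewrite fE -AdM mulVg Ad1.
Qed.

(** The elements preserving [W] form a subgroup containing every exponential from [U], hence the
    whole subgroup generated by them. *)
Lemma lie_subgroup_stable U W a w : bracket_stable U W -> lie_subgroup L U a ->
  w \in W -> Ad L a w \in W.
Proof.
move=> UW aU; move: w.
apply: (aU [set b | forall w, w \in W -> Ad L b w \in W]); first split.
- by move=> w; rewrite Ad1.
- by move=> b d bW dW w wW; rewrite AdM; exact/bW/dW.
- by move=> b bW w; exact: Ad_stableV.
by move=> x y xU xy w; apply: (is_exp_stable xy) => v; exact: UW.
Qed.

(** For any subgroup [S] containing the exponentials from [U], the elements whose conjugate by [a]
    lies in [S] form another such subgroup. *)
Lemma lie_subgroup_conjg U a y : (forall x, x \in U -> Ad L a x \in U) ->
  lie_subgroup L U y -> lie_subgroup L U (a * y * a^-1)%g.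
Proof.
move=> aU yU S [S1 SM SV] Sexp.
apply: (yU [set b | S (a * b * a^-1)%g]); first split.
- by rewrite /= mulg1 mulgV.
- move=> b d Sb Sd.
  by have := SM _ _ Sb Sd; rewrite /= -[(a * d * _)%g]mulgA divgKA !mulgA.
- by move=> b /SV; rewrite /= !invgM invgK mulgA.
by move=> x z xU xz; apply: (Sexp (Ad L a x)); [exact: aU|exact: is_exp_conjg].
Qed.

End Adjoint.

Theorem theorem3 (R : realType) (g : lieAlgType R[i])
    (semisimple_g : semisimple_alg g)
    (D : triangular g)
    (e : dualsp (tri_h D) -> g) (e_root : root_vectors e)
    (n : nat) (G : complexLieGroupType R n) (L : lie_algebra_of G g)
    (sc_G : simply_connected R G)
    (a : G) (a_H : lie_subgroup L (tri_h D) a)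
    (tau : g) (tau_r : rm_cross e tau) :
  [set coad L D a v | v in coad_orbit L D tau]
    = coad_orbit L D (coad L D a tau).
Proof.
have aV_H : lie_subgroup L (tri_h D) a^-1%g.
  by move=> S Ssub Sexp; have [_ _ SV] := Ssub; apply: SV; exact: a_H.
have h_conj b u : lie_subgroup L (tri_h D) b -> lie_subgroup L (tri_n D) u ->
    lie_subgroup L (tri_n D) (b * u * b^-1)%g.
  move=> bH; apply: lie_subgroup_conjg => x.
  exact: lie_subgroup_stable (@tri_h_n_stable _ _ D) bH.
have h_b := lie_subgroup_stable (tri_b_stable (addvSl _ _)) a_H.
have n_b u (uN : lie_subgroup L (tri_n D) u) :=
  lie_subgroup_stable (tri_b_stable (addvSr _ _)) uN.
(* [v] and [proj_nm D v] differ by an element of [tri_b D], which [Ad L b] preserves and [proj_nm D]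
   kills. *)
have coad_proj b v : (forall w, w \in tri_b D -> Ad L b w \in tri_b D) ->
    coad L D b (proj_nm D v) = proj_nm D (Ad L b v).
  move=> bb; apply/esym/eqP; rewrite /coad -subr_eq0 -linearB.
  have -> : Ad L b v - Ad L b (proj_nm D v) = Ad L b (v - proj_nm D v).
    by rewrite linearB.
  by apply/eqP; apply: proj_nm_eq0; apply: bb; exact: sub_proj_nm.
have comm u : lie_subgroup L (tri_n D) u ->
    coad L D a (coad L D u tau) = coad L D (a * u * a^-1)%g (coad L D a tau).
  move=> uN; rewrite coad_proj // coad_proj; last first.
    by move=> w; apply: n_b; exact: h_conj.
  by rewrite -[in RHS]AdM -mulgA mulVg mulg1 AdM.
apply/seteqP; split=> [_ [_ [u uN <-] <-]|_ [u uN <-]].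
  by exists (a * u * a^-1)%g; [exact: h_conj|rewrite comm].
(* For the reverse inclusion, [u] is the conjugate by [a] of [a^-1 * u * a], which lies in the
   subgroup of [tri_n D] because [a^-1] normalizes it too. *)
have uN' := h_conj _ _ aV_H uN; rewrite invgK in uN'.
exists (coad L D (a^-1 * u * a)%g tau); first by exists (a^-1 * u * a)%g.
have uE : (a * (a^-1 * u * a) * a^-1 = u)%g.
  by rewrite !mulgA mulgV mul1g -mulgA mulgV mulg1.
by rewrite (comm _ uN') uE.
Qed.
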